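(* If there is a cardinal $\mu\in\mathbf{S}$ with $\mu\ge\mathfrak{c}$, then there is a Hausdorff locally convex topological $\mathbb{R}$-vector space whose underlying topological space is a pd-example.
   Context: For a family of sets $\mathcal{A}$, $\mathrm{pd}(\mathcal{A})$ is the smallest cardinality of a set that intersects every non-empty member of $\mathcal{A}$. A neighborhood assignment on a topological space $X$ is a family $\{U_x : x\in X\}$ where each $U_x$ is an open subset of $X$ containing $x$. The pinning down number of $X$ is $\mathrm{pd}(X)=\sup\{\mathrm{pd}(\mathcal{U}) : \mathcal{U}\text{ is a neighborhood assignment on }X\}$. $\mathrm{d}(X)$ is the density of $X$. $X$ is called a pd-example if $\mathrm{pd}(X)<\mathrm{d}(X)$. $\mathbf{S}$ is the class of all singular cardinals that are not strong limit, and $\mathfrak{c}=2^{\aleph_0}$. *)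

(* Defs.v *)
From HB Require Import structures.
From mathcomp Require Import all_boot all_order all_algebra.
From mathcomp Require Import all_classical all_reals all_analysis.
From mathcomp Require Import wochoice.

Set Implicit Arguments.
Unset Strict Implicit.
Unset Printing Implicit Defensive.

Local Open Scope classical_set_scope.
Local Open Scope card_scope.

(* A cardinal is represented by any set of that cardinality.  A cardinal that
   is at most #|T| is represented by a subset of T; this keeps the
   quantifications over cardinals below independent of universe levels. *)

Definition card_lt (T U : Type) (A : set T) (B : set U) : Prop :=
  A #<= B /\ ~ (B #<= A).

(* K represents the least cardinality of a member of F *)
Definition is_least_card (T : Type) (F : set (set T)) (K : set T) : Prop :=
  (exists2 A, F A & A #= K) /\ (forall A, F A -> K #<= A).

(* K represents the supremum of the cardinals represented by members of F *)
Definition is_sup_card (T : Type) (F : set (set T)) (K : set T) : Prop :=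
  (forall A, F A -> A #<= K) /\
  (forall L : set T, (forall A, F A -> A #<= L) -> K #<= L).

(* R well-orders M in the order type of the initial ordinal of #|M| *)
Definition initial_well_order (M : Type) (R : rel M) : Prop :=
  well_order R /\
  (forall x, card_lt [set y | R y x /\ y <> x] [set: M]).

(* C represents the cofinality cf(#|M|); it does not depend on R, which is
   unique up to isomorphism. *)
Definition is_cofinality (M : Type) (C : set M) : Prop :=
  exists2 R : rel M, initial_well_order R &
    is_least_card [set A | forall x, exists2 y, A y & R x y] C.

Definition singular_card (M : Type) : Prop :=
  infinite_set [set: M] /\
  (exists2 C : set M, is_cofinality C & card_lt C [set: M]).

Definition strong_limit_card (M : Type) : Prop :=
  infinite_set [set: M] /\
  (forall L : set M, card_lt L [set: M] ->
     card_lt [set A : set M | A `<=` L] [set: M]).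

Definition class_S (M : Type) : Prop :=
  singular_card M /\ ~ strong_limit_card M.

Definition is_pd_family (T : Type) (A : set (set T)) (K : set T) : Prop :=
  is_least_card [set P | forall B, A B -> B !=set0 -> P `&` B !=set0] K.

Definition neighborhood_assignment (X : topologicalType) (U : X -> set X) :
    Prop :=
  forall x, open (U x) /\ U x x.

(* Every pd(U) is at most #|X|, hence is represented by a subset of X. *)
Definition is_pinning_down_number (X : topologicalType) (K : set X) : Prop :=
  is_sup_card
    [set L | exists2 U : X -> set X,
       neighborhood_assignment U & is_pd_family (range U) L] K.

Definition is_density (X : topologicalType) (K : set X) : Prop :=
  is_least_card [set D : set X | dense D] K.

Definition pd_example (X : topologicalType) : Prop :=
  exists K D : set X,
    [/\ is_pinning_down_number K, is_density D & card_lt K D].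

(* Main.v *)
Require Import Defs.
From HB Require Import structures.
From mathcomp Require Import all_boot all_order all_algebra.
From mathcomp Require Import all_classical all_reals all_analysis.
From mathcomp Require Import wochoice.
From mathcomp Require Import ring lra.

(** Let mu be the cardinality of M, let kappa < mu be its cofinality, and let
    lambda < mu satisfy mu <= 2^lambda, which exists because mu is not strong
    limit.  The space is a subspace V of a product R^F of real lines such that
    any fewer than mu open sets are met by a small set of points, although no
    small set is dense.

    Well-order M in type mu.  Let I be a set of kappa many indices i, each
    standing for an infinite initial segment M_i of M, cofinal in M.  Above
    each of them choose h_i minimal such that the initial segment below h_i
    has more than |M_i| elements.  Then any |M_i| many elements below h_i are
    bounded below h_i ([rung_height]), as if h_i were the cardinal successor
    of |M_i|.

    The set F of coordinates consists of the functions f : I -> M with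
    f(i) < h_i for all large i.  As M embeds in the power set of a set of size
    lambda, F embeds in a power set 2^(kappa * lambda), so the argument of
    Hewitt, Marczewski and Pondiczery yields kappa * lambda many points b_xi
    of R^F that form a dense set ([value_dense]).  The generator indexed by
    (i, a, xi) is the function on F that equals b_xi at the coordinates f with
    f(i) <= a < h_i and vanishes at the other ones.  The space V is the linear
    span of the generators, with the topology of R^F.  It has at most mu
    points, because mu is at least the continuum ([ladder_card]).

    - Fewer than mu vectors are not dense ([ladder_not_dense]).  If there are
      at most |M_(i0)| of them, then for each i >= i0 the values a < h_i that
      occur in generators (i, a, xi) of their expansions are strictly bounded
      by some f(i) < h_i.  With f(i) = h_i for the other i, the coordinate f
      annihilates all these vectors, but not V.
    - A neighborhood assignment is pinned down by kappa * lambda points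
      ([ladder_pinning]).  Number the points of V by elements of M, and let
      V_c be the set of those numbered below the index c.  The neighborhood
      of x is determined by a finite set of coordinates f.  For i >= c, there
      are at most |M_i| many values f(i) < h_i as x runs over V_c, so that
      they are bounded by a single g_c(i) < h_i.  Given x in V_c and i large
      enough, all coordinates f relevant to x satisfy f(i) <= g_c(i), so on
      these coordinates the generators (i, g_c(i), xi) coincide with the dense
      family b_xi, and one of them lies in the neighborhood of x.

    Hence pd(V) <= kappa * lambda < mu <= d(V) ([pd_example_of_pinning]).
    Cardinal arithmetic enters through A * A ~ A for infinite A
    ([emb_square]), from which the sets of finite sequences that index linear
    combinations and dense points get their sizes. *)

Set Implicit Arguments.
Unset Strict Implicit.
Unset Printing Implicit Defensive.

Import Order.TTheory GRing.Theory Num.Theory.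
Import numFieldNormedType.Exports.
Local Open Scope classical_set_scope.
Local Open Scope card_scope.
Local Open Scope ring_scope.

(** * Cardinal comparison of types *)

(** Types rather than sets are compared, so that products, sequences and power
    sets are those of the type theory; a set stands for the type of its
    elements. *)
Definition emb (A B : Type) := exists f : A -> B, injective f.

Lemma emb_refl A : emb A A.
Proof. by exists id. Qed.

Lemma emb_trans B A C : emb A B -> emb B C -> emb A C.
Proof. by move=> [f fi] [g gi]; exists (g \o f); exact: inj_comp. Qed.

Lemma emb_surj A B (f : A -> B) : (forall b, exists a, f a = b) -> emb B A.
Proof.
by move=> /choice[g gK]; exists g => x y /(congr1 f); rewrite !gK.
Qed.

Lemma card_le_emb T U (A : set T) (B : set U) : A #<= B <-> emb A B.
Proof.
split=> [/card_leP[f]|[f fi]]; first by exists f; exact: in2TT 'inj_f.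
by apply/card_leP; apply/injfunPex; exists f => // x y _ _; exact: fi.
Qed.

Lemma emb_setT T : emb T [set: T] /\ emb [set: T] T.
Proof.
split; last by exists val; exact: val_inj.
by exists (fun x => SigSub (mem_set (I : setT x))) => x y /(congr1 val).
Qed.

Lemma emb_set T (A B : set T) : A `<=` B -> emb A B.
Proof. by move=> AB; apply/card_le_emb; exact: subset_card_le. Qed.

(** Cardinals are well-founded and comparable, by Hoenig's argument: take a
    maximal set S of choice functions any two of which differ at every index.
    Were no coordinate projection of S onto, a function avoiding all
    projections could be added to S.  So some projection is a bijection, and
    composing its inverse with the other projections embeds the corresponding
    type in all others. *)
Lemma emb_min (J : Type) (j0 : J) (T : J -> Type) :
  exists j, forall k, emb (T j) (T k).
Proof.
pose P (S : set (forall j, T j)) :=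
  forall s t, S s -> S t -> (exists j, s j = t j) -> s = t.
have [|S [PS Smax]] := @Zorn_bigcup _ P.
  move=> F FP Ftot s t [X FX Xs] [Y FY Yt] st.
  have [XY|YX] := Ftot _ _ FX FY.
    by apply: (FP _ FY) st => //; exact: XY.
  by apply: (FP _ FX) st => //; exact: YX.
have [j jS] : exists j, forall a : T j, exists2 s, S s & s j = a.
  apply: contrapT => noj.
  have H j : exists a : T j, forall s, S s -> s j <> a.
    apply: contrapT => nH; apply: noj; exists j => a; apply: contrapT => na.
    by apply: nH; exists a => s Ss sa; apply: na; exists s.
  pose a j := sval (cid (H j)).
  have aP j s : S s -> s j <> a j by exact: (svalP (cid (H j))).
  have Sa : ~ S a by move=> /(aP j0).
  apply: (Smax (S `|` [set a])).
    by split=> [s Ss|E]; [left|apply: Sa; apply: E; right].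
  move=> s t [Ss|->] [St|->] [j st] //; first by apply: PS => //; exists j.
    by case: (aP j _ Ss).
  by case: (aP j _ St).
exists j => k.
have /choice[g gP] : forall a : T j, exists s, S s /\ s j = a.
  by move=> a; have [s Ss sa] := jS a; exists s.
exists (fun a => g a k) => a b gab.
have [Sa <-] := gP a; have [Sb <-] := gP b.
by rewrite (PS _ _ Sa Sb)//; exists k.
Qed.

Lemma emb_total A B : emb A B \/ emb B A.
Proof.
have [[] H] := emb_min true (fun b : bool => if b then A else B).
  by left; exact: (H false).
by right; exact: (H true).
Qed.

Lemma emb_mul A B A' B' : emb A A' -> emb B B' -> emb (A * B) (A' * B').
Proof.
move=> [f fi] [g gi]; exists (fun x => (f x.1, g x.2)).
by move=> [a b] [c d] /= [/fi -> /gi ->].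
Qed.

Section Square.
Variable A : Type.

(** Partial pairing functions are encoded by their graphs, so that a chain of
    them is glued by union; the domain of a graph is read off its diagonal. *)
Definition sq_dom (G : set (A * A * A)) := [set x | exists z, G (x, x, z)].

Definition square_graph (G : set (A * A * A)) :=
  [/\ forall x y z, G (x, y, z) -> [/\ sq_dom G x, sq_dom G y & sq_dom G z],
      forall x y, sq_dom G x -> sq_dom G y -> exists z, G (x, y, z) &
      forall x y z x' y' z', G (x, y, z) -> G (x', y', z') ->
        z = z' <-> (x = x' /\ y = y')].

Lemma square_graph_emb G : square_graph G ->
  emb (sq_dom G * sq_dom G) (sq_dom G).
Proof.
move=> [Gd Gt Gi].
have /choice[f fP] : forall x : sq_dom G * sq_dom G, exists z : sq_dom G,
    G (val x.1, val x.2, val z).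
  move=> -[x y] /=; have [z Gz] := Gt _ _ (set_mem (valP x)) (set_mem (valP y)).
  have [_ _ zd] := Gd _ _ _ Gz.
  by exists (SigSub (mem_set zd)).
exists f => -[x y] [x' y'] fxy; have := fP (x, y); have := fP (x', y').
rewrite fxy /= => G1 G2; have [/(_ erefl)[]] := Gi _ _ _ _ _ _ G2 G1.
by move=> /val_inj -> /val_inj ->.
Qed.

(** Any two elements of the domain of the union already belong to the domain
    of one member of the chain. *)
Lemma square_graph_bigcup (F : set (set (A * A * A))) :
  F !=set0 -> F `<=` square_graph -> total_on F subset ->
  square_graph (\bigcup_(X in F) X).
Proof.
move=> [X0 FX0] FP Ftot.
have dF x : sq_dom (\bigcup_(X in F) X) x -> exists2 X, F X & sq_dom X x.
  by move=> [z [X FX Xz]]; exists X => //; exists z.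
have dU X : F X -> sq_dom X `<=` sq_dom (\bigcup_(X in F) X).
  by move=> FX x [z Xz]; exists z, X.
have sub (X Y : set (A * A * A)) : X `<=` Y -> sq_dom X `<=` sq_dom Y.
  by move=> XY x [z /XY]; exists z.
split.
- move=> x y z [X FX Xz]; have [Xd _ _] := FP _ FX.
  by have [? ? ?] := Xd _ _ _ Xz; split; exact: (dU X).
- move=> x y /dF[X FX Xx] /dF[Y FY Yy].
  have [XY|YX] := Ftot _ _ FX FY.
    have [_ /(_ x y)[|//|z]] := FP _ FY; first exact: sub XY _ Xx.
    by exists z, Y.
  have [_ /(_ x y)[//||z]] := FP _ FX; first exact: sub YX _ Yy.
  by exists z, X.
- move=> x y z x' y' z' [X FX Xz] [Y FY Yz].
  have [XY|YX] := Ftot _ _ FX FY.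
    by have [_ _] := FP _ FY; apply=> //; exact: XY.
  by have [_ _] := FP _ FX; apply=> //; exact: YX.
Qed.

Lemma square_graph_nat : emb nat A ->
  exists2 G, square_graph G & emb nat (sq_dom G).
Proof.
move=> [i ii].
have e : emb [set: nat * nat] [set: nat].
  apply/card_le_emb; have := card_nat2.
  by rewrite card_eq_le => /andP[].
have [p pi] : emb (nat * nat) nat.
  by apply: emb_trans (proj1 (emb_setT _)) (emb_trans e (proj2 (emb_setT _))).
pose G := [set t | exists m n, t = (i m, i n, i (p (m, n)))].
have dG n : sq_dom G (i n) by exists (i (p (n, n))), n, n.
have Gd x : sq_dom G x -> exists n, x = i n by move=> [z [m [n [-> _ _]]]]; exists m.
exists G; last by exists (fun n => SigSub (mem_set (dG n))) => m n /(congr1 val)/ii.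
split.
- by move=> _ _ _ [m [n [-> -> ->]]].
- by move=> x y /Gd[m ->] /Gd[n ->]; exists (i (p (m, n))), m, n.
- move=> _ _ _ _ _ _ [m [n [-> -> ->]]] [m' [n' [-> -> ->]]]; split.
    by move=> /ii/pi[-> ->].
  by move=> [/ii -> /ii ->].
Qed.

End Square.

Lemma emb_bool : emb bool nat.
Proof. by exists nat_of_bool => -[] []. Qed.

(** A maximal injective pairing on a subset B of A extending one on a
    countable subset lives on a set of full cardinality.  If the complement of
    B embeds in B then A embeds in bool * B, hence in B * B and in B.
    Otherwise the complement contains a copy c(B) of B, and the pairing extends
    to B together with c(B), using c(B) for the values on the new pairs. *)
Lemma emb_square A : emb nat A -> emb (A * A) A.
Proof.
move=> nA; have [G0 G0P nG0] := square_graph_nat nA.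
(* The union with G0 lets the empty chain satisfy the predicate. *)
pose P G := square_graph (G0 `|` G).
have [|G [PG Gmax]] := @Zorn_bigcup _ P.
  move=> F FP Ftot.
  rewrite /P; have -> : G0 `|` \bigcup_(X in F) X =
      \bigcup_(Y in [set G0] `|` [set G0 `|` X | X in F]) Y.
    apply/seteqP; split=> [t [G0t|[X FX Xt]]|t [_ [->|[X FX <-]]]].
    - by exists G0 => //; left.
    - by exists (G0 `|` X); [right; exists X|right].
    - by left.
    - by move=> [|Xt]; [left|right; exists X].
  apply: square_graph_bigcup.
  - by exists G0; left.
  - by move=> _ [->//|[X FX <-]]; exact: FP.
  - move=> _ _ [->|[X FX <-]] [->|[Y FY <-]].
    + by left.
    + by left; left.
    + by right; left.
    + by have [XY|YX] := Ftot _ _ FX FY; [left|right]; exact: setUS.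
rewrite /P in PG; set G1 := G0 `|` G in PG.
pose B := sq_dom G1.
have BB : emb (B * B) B by exact: square_graph_emb.
have nB : emb nat B.
  apply: emb_trans nG0 _; apply: emb_set => x [z Gz]; by exists z; left.
have bB : emb (bool * B) B.
  exact: emb_trans (emb_mul (emb_trans emb_bool nB) (emb_refl B)) BB.
have [CB|[c ci]] := emb_total (~` B) B.
  have AB : emb A B.
    apply: emb_trans bB; have [c ci] := CB.
    apply: (@emb_trans (B + ~` B)%type).
      apply: (@emb_surj _ _ (fun s : B + ~` B => match s with inl x => val x | inr x => val x end)).
      move=> a; have [Ba|nBa] := pselect (B a).
        by exists (inl (SigSub (mem_set Ba))).
      by exists (inr (SigSub (mem_set (nBa : (~` B) a)))).
    exists (fun s : B + ~` B => match s with inl x => (true, x) | inr x => (false, c x) end).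
    by move=> [x|x] [y|y] // [] => [->|/ci ->].
  apply: emb_trans (emb_mul AB AB) (emb_trans BB _).
  by exists val; exact: val_inj.
exfalso.
pose B' := [set x | B x \/ exists b, x = val (c b)].
have B'B : emb B' B.
  apply: emb_trans bB.
  have H (s : bool * B) : B' (if s.1 then val s.2 else val (c s.2)).
    by case: s => -[] b /=; [left; exact: set_mem (valP b)|right; exists b].
  apply: (@emb_surj _ _ (fun s => SigSub (mem_set (H s)))) => -[x xB'].
  have [Bx|[b xb]] := set_mem xB'.
    by exists (true, SigSub (mem_set Bx)); exact: val_inj.
  by exists (false, b); apply: val_inj => /=.
have [k ki] : emb (B' * B') B by exact: emb_trans (emb_mul B'B B'B) BB.
have cB b : ~ B (val (c b)) by exact: set_mem (valP (c b)).
pose H := [set t | exists x y : B', ~ (B (val x) /\ B (val y)) /\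
  t = (val x, val y, val (c (k (x, y))))].
have [Gd Gt Gi] := PG.
have B'E (x : A) : B' x -> exists x' : B', val x' = x.
  by move=> B'x; exists (SigSub (mem_set B'x)).
have domE : sq_dom (G1 `|` H) = B'.
  apply/seteqP; split=> x.
    move=> [z [Gz|[x1 [y1 [_ [-> _ _]]]]]]; first by left; exists z.
    exact: set_mem (valP x1).
  move=> B'x; have [Bx|nBx] := pselect (B x).
    by have [z Gz] := Bx; exists z; left.
  have [x' x'E] := B'E _ B'x.
  exists (val (c (k (x', x')))); right; exists x', x'; rewrite x'E; split=> //.
  by case.
have [n0] := nB; move=> n0i; pose b0 := n0 0%N.
have B'c b : B' (val (c b)) by right; exists b.
have PH : square_graph (G1 `|` H).
  split; rewrite ?domE.
  - move=> x y z [Gz|[x' [y' [_ [-> -> ->]]]]].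
      by have [? ? ?] := Gd _ _ _ Gz; split; left.
    split; [exact: set_mem (valP x')|exact: set_mem (valP y')|exact: B'c].
  - move=> x y B'x B'y; have [[Bx By]|nB2] := pselect (B x /\ B y).
      by have [z] := Gt x y Bx By; exists z; left.
    have [x' x'E] := B'E _ B'x; have [y' y'E] := B'E _ B'y.
    exists (val (c (k (x', y')))); right; exists x', y'.
    by rewrite x'E y'E.
  - move=> x y z x' y' z' [Gz|[x1 [y1 [n1 [-> -> ->]]]]]
      [Gz'|[x2 [y2 [n2 [-> -> ->]]]]].
    + exact: Gi Gz Gz'.
    + have [Bx By Bz] := Gd _ _ _ Gz; split.
        move=> zc; have /= := @cB (k (x2, y2)); rewrite -zc.
        by move=> /(_ Bz).
      by move=> [xE yE]; case: n2; rewrite xE yE in Bx By.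
    + have [Bx By Bz] := Gd _ _ _ Gz'; split.
        move=> zc; have /= := @cB (k (x1, y1)); rewrite zc.
        by move=> /(_ Bz).
      by move=> [xE yE]; case: n1; rewrite -xE -yE in Bx By.
    + split; first by move=> /val_inj/ci/ki[-> ->].
      by move=> [/val_inj -> /val_inj ->].
apply: (Gmax (G1 `|` H)); last first.
  rewrite /P; suff -> : G0 `|` (G1 `|` H) = G1 `|` H by [].
  by apply/seteqP; split=> t; [move=> [G0t|//]; left; left|right].
split; first by move=> t Gt'; left; right.
move=> sub; apply: (cB b0).
have [x' x'E] := B'E _ (B'c b0).
exists (val (c (k (x', x')))); right; apply: sub; right; exists x', x'.
by rewrite x'E; split=> // -[/cB].
Qed.

Lemma emb_prod A B M : emb nat M -> emb A M -> emb B M -> emb (A * B) M.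
Proof. by move=> /emb_square MM AM BM; exact: emb_trans (emb_mul AM BM) MM. Qed.

(** Sequences of a given length are coded injectively by iterated pairing, and
    the length is recorded next to the code. *)
Lemma emb_seq A M : emb nat M -> emb A M -> emb (seq A) M.
Proof.
move=> nM [i ii]; have [q qi] := emb_square nM; have [n ni] := nM.
apply: emb_trans (emb_prod nM nM (emb_refl M)).
exists (fun s => (size s, foldr (fun a m => q (i a, m)) (n 0) s)).
elim=> [|a s IH] [|b t] //= [st /qi[/ii -> H]].
by congr cons; apply: IH; rewrite st H.
Qed.

Lemma emb_option_seq A : emb (option A) (seq A).
Proof.
exists (fun o => if o is Some a then [:: a] else [::]).
by move=> [a|] [b|] //= [->].
Qed.

Lemma emb_option A M : emb nat M -> emb A M -> emb (option A) M.
Proof.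
by move=> nM AM; exact: emb_trans (emb_option_seq A) (emb_seq nM AM).
Qed.

(** The product of two cardinals below an uncountable cardinal is below it: it
    is countable, or it is the larger of the two. *)
Lemma nemb_prod M A B : ~ emb M nat -> ~ emb M A -> ~ emb M B ->
  ~ emb M (A * B).
Proof.
move=> Mn.
wlog AB : A B / emb A B => [H MA MB MAB|MA MB MAB].
  have [AB|BA] := emb_total A B; first exact: H MAB.
  apply: (H B A) => //; apply: emb_trans MAB _.
  by exists (fun x => (x.2, x.1)) => -[a b] [c d] /= [-> ->].
have [nB|Bn] := emb_total nat B.
  by apply: MB; exact: emb_trans MAB (emb_prod nB AB (emb_refl B)).
apply: Mn; apply: emb_trans MAB (emb_prod (emb_refl _) _ Bn).
exact: emb_trans AB Bn.
Qed.

Lemma nemb_seq M A : ~ emb M nat -> ~ emb M A -> ~ emb M (seq A).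
Proof.
move=> Mn MA MsA; have [nA|An] := emb_total nat A.
  by apply: MA; exact: emb_trans MsA (emb_seq nA (emb_refl A)).
by apply: Mn; exact: emb_trans MsA (emb_seq (emb_refl _) An).
Qed.

Lemma nemb_option M A : ~ emb M nat -> ~ emb M A -> ~ emb M (option A).
Proof.
move=> Mn MA Mo; apply: (nemb_seq Mn MA).
exact: emb_trans Mo (emb_option_seq A).
Qed.

(** Cantor's diagonal argument. *)
Lemma nemb_power (T : Type) : ~ emb (set T) T.
Proof.
move=> [i ii]; pose D := [set t | exists2 A : set T, i A = t & ~ A t].
have nD : ~ D (i D) by move=> DD; have [A /ii AD nA] := DD; apply: nA; rewrite AD.
by apply: (nD); exists D.
Qed.

Lemma emb_count (T : countType) : emb T nat.
Proof. by exists pickle; exact: (pcan_inj pickleK). Qed.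

(** A real number is determined by the rational numbers below it. *)
Lemma emb_real (R : realType) : emb R (set nat).
Proof.
exists (fun x => [set n | exists2 q : rat, pickle q = n & ratr q < x]).
suff H (x y : R) : x < y -> [set n | exists2 q : rat, pickle q = n & ratr q < x] <>
    [set n | exists2 q : rat, pickle q = n & ratr q < y].
  move=> x y /= xy; apply/eqP; rewrite eq_le !leNgt.
  by apply/andP; split; apply/negP => /H; apply.
move=> xy E; have [q] := rat_in_itvoo xy; rewrite in_itv /= => /andP[xq qy].
have : [set n | exists2 q : rat, pickle q = n & ratr q < y] (pickle q).
  by exists q.
rewrite -E => -[q' /(pcan_inj pickleK) ->].
by move=> /(lt_trans xq); rewrite ltxx.
Qed.

(** * Ladders in a well-ordered singular cardinal *)

Section WellOrder.
Variables (M : Type) (le : rel M).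
Hypothesis le_wo : well_order le.

Definition strict x y := le x y /\ x <> y.

Definition seg x : set M := [set y | strict y x].

Lemma wo_min (P : set M) : P !=set0 -> exists2 m, P m & forall x, P x -> le m x.
Proof.
move=> [x Px]; have [|m [[/set_mem Pm mP] _]] := @le_wo (mem P).
  by exists x; exact: mem_set.
by exists m => // y /mem_set/mP.
Qed.

Lemma wo_refl x : le x x.
Proof. by have [_ -> /(_ x erefl)] := @wo_min [set x] (ex_intro _ x erefl). Qed.

Lemma wo_total x y : le x y \/ le y x.
Proof.
have [|_ [] -> H] := @wo_min [set x; y]; first by exists x; left.
  by left; apply: H; right.
by right; apply: H; left.
Qed.

Lemma wo_anti x y : le x y -> le y x -> x = y.
Proof.
move=> xy yx; have [|m [_ muniq]] := @le_wo (mem [set x; y]).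
  by exists x; apply/mem_set; left.
have <- : m = x.
  apply: muniq; split=> [|z /set_mem[]->//]; last exact: wo_refl.
  by apply/mem_set; left.
apply: muniq; split=> [|z /set_mem[]->//]; last exact: wo_refl.
by apply/mem_set; right.
Qed.

Lemma wo_trans y x z : le x y -> le y z -> le x z.
Proof.
move=> xy yz; have [|_ [[->|->]|->] H] := @wo_min [set x; y; z].
- by exists x; left; left.
- by apply: H; right.
- by rewrite (wo_anti xy) //; apply: H; left; left.
- by rewrite -(wo_anti yz) //; apply: H; left; right.
Qed.

Lemma strict_le x y : strict x y -> le x y. Proof. by case. Qed.

Lemma strictNge x y : strict x y <-> ~ le y x.
Proof.
split=> [[xy nxy] yx|nyx]; first exact: nxy (wo_anti xy yx).
split; first by have [] := wo_total x y.
by move=> xy; apply: nyx; rewrite xy; exact: wo_refl.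
Qed.

Lemma strict_le_trans y x z : strict x y -> le y z -> strict x z.
Proof.
move=> /strictNge nyx yz; apply/strictNge => zx.
by apply: nyx; exact: wo_trans zx.
Qed.

Lemma seg_le x y : le x y -> seg x `<=` seg y.
Proof. by move=> xy z zx; exact: strict_le_trans xy. Qed.

Lemma wo_bound_seq (T : eqType) (s : seq T) (u : T -> M) : inhabited M ->
  exists b, forall t, t \in s -> le (u t) b.
Proof.
move=> [m0]; elim: s => [|t s [b bs]]; first by exists m0.
have [tb|bt] := wo_total (u t) b.
  by exists b => z; rewrite inE => /orP[/eqP->|/bs].
exists (u t) => z; rewrite inE => /orP[/eqP->|/bs zb]; first exact: wo_refl.
exact: wo_trans zb bt.
Qed.

Section Ladder.
Hypothesis seg_small : forall x, ~ emb M (seg x).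
Hypothesis M_uncountable : ~ emb M nat.
Variable C : set M.
Hypothesis C_cofinal : forall x, exists2 y, C y & le x y.
Hypothesis C_small : ~ emb M C.

Lemma emb_cofinal_cover (I X : Type) (p : I -> M) :
  (forall x, exists i, strict x (p i)) -> (forall i, emb (seg (p i)) X) ->
  emb M (I * X).
Proof.
move=> /choice[c cP] pX.
pose e i := sval (cid (pX i)); have ei i : injective (e i) := svalP (cid (pX i)).
exists (fun x => (c x, e (c x) (SigSub (mem_set (cP x : seg (p (c x)) x))))) => x y [].
move: (cP x) (cP y) => + + cxy; rewrite -cxy => sx sy /ei.
by move=> /(congr1 val).
Qed.

(** A largest element would make M the union of a small initial segment and a
    singleton. *)
Lemma wo_nomax x : exists y, strict x y.
Proof.
apply: contrapT => nx; apply: (nemb_option M_uncountable (@seg_small x)).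
apply: (@emb_surj _ _ (fun o : option (seg x) => if o is Some y then val y else x)).
move=> y; have [->|yx] := pselect (y = x); first by exists None.
have sy : strict y x.
  split=> //; have [//|xy] := wo_total y x; case: nx; exists y; split=> // xy'.
  exact: yx.
by exists (Some (SigSub (mem_set (sy : seg x y)))).
Qed.

(** Indices with a finite initial segment are discarded: the bounds below
    absorb the product of a segment with nat, or with itself. *)
Definition rung : set M := [set c | C c /\ emb nat (seg c)].

Lemma rung_small : ~ emb M rung.
Proof.
by move=> H; apply: C_small; apply: emb_trans H (emb_set _) => c [].
Qed.

Lemma C_strict_cofinal x : exists c : C, strict x (val c).
Proof.
have [y xy] := wo_nomax x; have [c Cc yc] := C_cofinal y.
by exists (SigSub (mem_set Cc)); exact: strict_le_trans xy yc.
Qed.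

(** If every initial segment below an element of C were finite, then M would
    be covered by few finite sets. *)
Lemma rung_cofinal x : exists i : rung, strict x (val i).
Proof.
have [x0 nx0] : exists x0, emb nat (seg x0).
  apply: contrapT => nx0.
  apply: (nemb_prod M_uncountable C_small M_uncountable).
  apply: (emb_cofinal_cover C_strict_cofinal) => c.
  have [H|//] := emb_total nat (seg (val c)).
  by case: nx0; exists (val c).
have {}nx0 y : le x0 y -> emb nat (seg y).
  by move=> xy; apply: emb_trans nx0 (emb_set _); exact: seg_le.
have [[c cC] xc] := C_strict_cofinal x; have [[d dC] xd] := C_strict_cofinal x0.
rewrite /= in xc xd; have [cd|dc] := wo_total c d.
  have rd : rung d by split; [exact: set_mem|exact/nx0/strict_le].
  by exists (SigSub (mem_set rd)); exact: strict_le_trans cd.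
have rc : rung c.
  by split; [exact: set_mem|apply/nx0; apply: wo_trans dc; exact: strict_le].
by exists (SigSub (mem_set rc)).
Qed.

Lemma rung_inf (i : rung) : emb nat (seg (val i)).
Proof. by have [] := set_mem (valP i). Qed.

(** The sizes of the segments are cofinal in the cardinals below |M|, since
    otherwise M would be a small union of uniformly small sets. *)
Lemma rung_exceeds X : ~ emb M X -> exists i : rung, ~ emb (seg (val i)) X.
Proof.
move=> MX; apply: contrapT => nX.
apply: (nemb_prod M_uncountable rung_small MX).
apply: (emb_cofinal_cover rung_cofinal) => i.
by apply: contrapT => niX; apply: nX; exists i.
Qed.

(** Here h i plays the role of a regular cardinal above |M_i|, although only
    the least height whose segment exceeds |M_i| is taken: an unbounded family
    of |M_i| elements below h i would cover its segment by |M_i| many sets of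
    size at most |M_i|. *)
Lemma rung_height : exists h : rung -> M, forall i S (g : S -> M),
  emb S (seg (val i)) ->
  exists b, strict b (h i) /\ forall s, strict (g s) (h i) -> strict (g s) b.
Proof.
have /choice[h hP] : forall i : rung, exists y, ~ emb (seg y) (seg (val i)) /\
    forall z, strict z y -> emb (seg z) (seg (val i)).
  move=> i; have [j nj] := rung_exceeds (@seg_small (val i)).
  have [|y ny ymin] := @wo_min [set y | ~ emb (seg y) (seg (val i))].
    by exists (val j).
  exists y; split=> // z /strictNge nyz; apply: contrapT => nz.
  by apply: nyz; exact: ymin.
exists h => i S g Si; have [nh hmin] := hP i; apply: contrapT => nb.
have iinf := rung_inf i.
apply: nh; apply: emb_trans (emb_prod iinf Si (emb_option iinf (emb_refl _))).
(* An unbounded g covers the segment below h i: send b to some s with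
   b <= g s, together with None if b = g s, and otherwise with the position of
   b in the segment below g s, which by minimality of h i is small. *)
have /choice[s sP] : forall b : seg (h i), exists s : S,
    strict (g s) (h i) /\ le (val b) (g s).
  move=> b; apply: contrapT => ns; apply: nb; exists (val b); split.
    exact: set_mem (valP b).
  by move=> s gs; apply/strictNge => bs; apply: ns; exists s.
have gX t : strict (g t) (h i) -> emb (seg (g t)) (seg (val i)) by exact: hmin.
pose e t gt := sval (cid (@gX t gt)).
have ei t gt : injective (e t gt) := svalP (cid (gX t gt)).
pose code (b : seg (h i)) : option (seg (val i)) :=
  if pselect (val b = g (s b)) is right ne then
    Some (e (s b) (sP b).1 (SigSub (mem_set (conj (sP b).2 ne : seg (g (s b)) (val b)))))
  else None.
exists (fun b => (s b, code b)) => a b [].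
rewrite /code; case: pselect => [aE|an]; case: pselect => [bE|bn] // sab.
  by move=> _; apply: val_inj; rewrite aE bE sab.
move: (sP a) (sP b) an bn; rewrite -sab => pa pb an bn.
rewrite (Prop_irrelevance pa.1 pb.1) => -[] /ei/(congr1 val) /= ?.
exact: val_inj.
Qed.

End Ladder.
End WellOrder.

(** * The weak topology of a family of linear functionals *)

Lemma dist_conv_lt (R : realFieldType) (a b c l e : R) : 0 < l -> l < 1 ->
  `|a - c| < e -> `|b - c| < e -> `|l * a + (1 - l) * b - c| < e.
Proof.
move=> l0 l1; rewrite !ltr_norml => /andP[? ?] /andP[? ?].
by apply/andP; split; nra.
Qed.

Lemma near_all_in_seq (F : eqType) (T : Type) (G : set_system T)
    (s : seq F) (P : F -> set T) :
  Filter G -> (forall f, f \in s -> G (P f)) ->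
  G [set y | forall f, f \in s -> P f y].
Proof.
move=> FG; elim: s => [|f s IH] sP; first by apply: filterE => y f.
have Gf : G (P f) by apply: sP; rewrite inE eqxx.
have Gs : G [set y | forall f, f \in s -> P f y].
  by apply: IH => g gs; apply: sP; rewrite inE gs orbT.
apply: filterS (filterI Gf Gs) => y [yf ys] g; rewrite inE => /orP[/eqP ->//|].
exact: ys.
Qed.

Section WeakTopology.
Variables (R : realType) (E : lmodType R) (F : eqType) (ev : F -> {scalar E}).

(** The vacuous binding keeps the functionals in the term, so that the
    topological structure can be inferred from the type. *)
Definition weak_lmod : Type := let _ := ev in E.
HB.instance Definition _ := GRing.Lmodule.on weak_lmod.

Implicit Types x y : weak_lmod.

Definition weak_ball x (s : seq F) (e : R) : set weak_lmod :=
  [set y | forall f, f \in s -> `|ev f y - ev f x| < e].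

Definition weak_nbhs x : set_system weak_lmod :=
  [set U | exists s (e : R), 0 < e /\ weak_ball x s e `<=` U].

HB.instance Definition _ := hasNbhs.Build weak_lmod weak_nbhs.

Lemma weak_ball_center x s (e : R) : 0 < e -> weak_ball x s e x.
Proof. by move=> e0 f _; rewrite subrr normr0. Qed.

Lemma weak_nbhs_ball x s (e : R) : 0 < e -> nbhs x (weak_ball x s e).
Proof. by move=> e0; exists s, e; split. Qed.

Let weak_nbhs_filter x : ProperFilter (nbhs x).
Proof.
split; first by move=> [s [e [e0 /(_ x)]]]; apply; exact: weak_ball_center.
split.
- by exists [::], 1; split=> //; exact: ltr01.
- move=> U V [s [e [e0 sU]]] [t [d [d0 tV]]].
  exists (s ++ t), (Num.min e d); split; first by rewrite lt_min e0 d0.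
  move=> y yst; split; [apply: sU|apply: tV] => f fs.
    by have := yst f; rewrite mem_cat fs lt_min => /(_ isT)/andP[].
  by have := yst f; rewrite mem_cat fs orbT lt_min => /(_ isT)/andP[].
- by move=> U V UV [s [e [e0 sU]]]; exists s, e; split=> // y /sU/UV.
Qed.

Let weak_nbhs_singleton x (U : set weak_lmod) : nbhs x U -> U x.
Proof. by move=> [s [e [e0 sU]]]; apply: sU; exact: weak_ball_center. Qed.

Let weak_nbhs_nbhs x (U : set weak_lmod) : nbhs x U -> nbhs x (nbhs^~ U).
Proof.
move=> [s [e [e0 sU]]]; have e20 : 0 < e / 2 by lra.
exists s, (e / 2); split=> // y ys; exists s, (e / 2); split=> // z zs.
apply: sU => f fs; rewrite [e]splitr.
rewrite (_ : _ - _ = (ev f z - ev f y) + (ev f y - ev f x)); last by ring.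
by apply: le_lt_trans (ler_normD _ _) _; apply: ltrD; [exact: zs|exact: ys].
Qed.

HB.instance Definition _ := Nbhs_isNbhsTopological.Build weak_lmod
  weak_nbhs_filter weak_nbhs_singleton weak_nbhs_nbhs.

Lemma ev_continuous f : continuous (fun x : weak_lmod => ev f x : R).
Proof.
move=> x; apply/(@cvgrPdist_lt _ _ _ _ (@nbhs_filter weak_lmod x)) => e e0.
exists [:: f], e; split=> // y; rewrite /weak_ball/= => /(_ f).
by rewrite inE eqxx distrC; exact.
Qed.

(** Continuity of the operations reduces to continuity of their composites
    with the functionals, hence to real limits. *)
Lemma cvg_weak (T : Type) (G : set_system T) (u : T -> weak_lmod) x :
  Filter G -> (forall f, (ev f \o u) @ G --> (ev f x : R)) -> u @ G --> x.
Proof.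
move=> FG ux U [s [e [e0 sU]]].
suff H : G [set t | forall f, f \in s -> `|ev f (u t) - ev f x| < e].
  by change (G (u @^-1` U)); apply: filterS H => t Ht; exact: sU.
apply: near_all_in_seq => f fs; have /cvgrPdist_lt/(_ e e0) := ux f.
by apply: filterS => t /=; rewrite distrC.
Qed.

Lemma open_weak_ball x s (e : R) : open (weak_ball x s e).
Proof.
rewrite openE => y ys.
apply: (near_all_in_seq (nbhs_filter y)
  (P := fun f z => `|ev f z - ev f x| < e)) => f fs.
have c : (fun z : weak_lmod => `|ev f z - ev f x|) @ y --> `|ev f y - ev f x|.
  apply: (@cvg_norm _ _ _ _ (nbhs_filter y)).
  by apply: (@cvgB _ _ _ _ (nbhs_filter y)); [exact: ev_continuous|exact: cvg_cst].
exact: (@cvgr_lt _ _ _ (nbhs_filter y) _ _ c _ (ys f fs)).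
Qed.

Let weak_add_continuous :
  continuous (fun x : weak_lmod * weak_lmod => x.1 + x.2).
Proof.
move=> [x y]; apply: cvg_weak => f /=.
rewrite linearD.
rewrite (_ : _ \o _ = (fun z : weak_lmod * weak_lmod => (ev f z.1 : R) + ev f z.2)).
  apply: cvgD.
    exact: (@cvg_comp _ _ _ fst (ev f) _ _ _ cvg_fst (@ev_continuous f x)).
  exact: (@cvg_comp _ _ _ snd (ev f) _ _ _ cvg_snd (@ev_continuous f y)).
by apply/funext => z /=; rewrite linearD.
Qed.

Let weak_scale_continuous :
  continuous (fun z : R^o * weak_lmod => z.1 *: z.2).
Proof.
move=> [k x]; apply: cvg_weak => f /=.
rewrite linearZ.
rewrite (_ : _ \o _ = (fun z : R^o * weak_lmod => (z.1 : R) * ev f z.2)).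
  apply: cvgM; first exact: cvg_fst.
  exact: (@cvg_comp _ _ _ snd (ev f) _ _ _ cvg_snd (@ev_continuous f x)).
by apply/funext => z /=; rewrite linearZ.
Qed.

Let weak_locally_convex : exists2 B : set_system weak_lmod,
  (forall b, b \in B -> convex_set b) & basis B.
Proof.
exists [set B | exists x s e, B = weak_ball x s e].
  move=> B /set_mem[x [s [e ->]]]; apply/convex_setW => y z ys zs k k0 k1.
  apply/mem_set => f fs; move/set_mem/(_ f fs): ys => ys.
  move/set_mem/(_ f fs): zs => zs.
  rewrite linearD !linearZ.
  exact: dist_conv_lt ys zs.
split; first by move=> _ [x [s [e ->]]]; exact: open_weak_ball.
move=> x U [s [e [e0 sU]]]; exists (weak_ball x s e) => //; split.
  by exists x, s, e.
exact: weak_ball_center.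
Qed.

HB.instance Definition _ := PreTopologicalLmod_isTvs.Build R weak_lmod
  weak_add_continuous weak_scale_continuous weak_locally_convex.
HB.instance Definition _ :=
  PreTopologicalNmodule_isTopologicalNmodule.Build weak_lmod weak_add_continuous.
HB.instance Definition _ := TopologicalNmodule_isTopologicalLmodule.Build
  R weak_lmod weak_scale_continuous.
HB.instance Definition _ :=
  Uniform_isTvs.Build R weak_lmod weak_locally_convex.

Lemma weak_hausdorff :
  (forall x y, (forall f, ev f x = ev f y) -> x = y) ->
  hausdorff_space weak_lmod.
Proof.
move=> sep x y xy; apply: sep => f; apply/eqP; rewrite -subr_eq0 -normr_eq0.
apply: contrapT => /negP; rewrite -normr_gt0 normr_id => d0.
set d := `|_| in d0; have d20 : 0 < d / 2 by lra.
have [z [xz yz]] := xy _ _ (weak_nbhs_ball x [:: f] d20)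
  (weak_nbhs_ball y [:: f] d20).
have := xz f; have := yz f; rewrite inE eqxx => /(_ isT) zy /(_ isT) zx.
suff : d < d / 2 + d / 2 by rewrite -splitr ltxx.
apply: le_lt_trans (ltrD zy zx); rewrite /d (_ : ev f x - ev f y =
  (ev f z - ev f y) - (ev f z - ev f x)); last by ring.
exact: ler_normB.
Qed.

End WeakTopology.

(** * The space attached to a ladder *)

Lemma all_flatten (T : Type) (P : pred T) (ss : seq (seq T)) :
  all P (flatten ss) = all (all P) ss.
Proof. by elim: ss => //= s ss IH; rewrite all_cat IH. Qed.

Lemma big_onth0 (K : nmodType) (T : Type) (s : seq T) (F : T -> K) :
  (forall n t, onth s n = Some t -> F t = 0) -> \sum_(t <- s) F t = 0.
Proof.
elim: s => [|t s IH] sF; first by rewrite big_nil.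
by rewrite big_cons (sF 0%N)// IH ?addr0// => n; exact: (sF n.+1).
Qed.

Section Construction.
Variables (K : realType) (M I L : Type) (le : rel M) (p h : I -> M).
Variable psi : M -> set L.
Hypothesis le_wo : well_order le.
Hypothesis psi_inj : injective psi.
Hypothesis p_cofinal : forall x, exists i, strict le x (p i).
Hypothesis p_inf : forall i, emb nat (seg le (p i)).
Hypothesis h_bound : forall i S (g : S -> M), emb S (seg le (p i)) ->
  exists b, strict le b (h i) /\
    forall s, strict le (g s) (h i) -> strict le (g s) b.

Definition coord := {f : I -> M |
  exists x, forall i, le x (p i) -> strict le (f i) (h i)}.

HB.instance Definition _ := gen_eqMixin coord.

Definition literal : Type := I * L * bool.
Definition label : Type := seq (seq literal * rat).

(** Through psi, a coordinate becomes a subset of I * L; a literal prescribes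
    whether one given pair belongs to this subset. *)
Definition satisfies (f : coord) (c : literal) :=
  `[< psi (sval f c.1.1) c.1.2 >] == c.2.

(** A label is a list of conjunctions of literals with rational weights; it
    stands for a step function with finitely many rational values, and these
    are the dense points of the product. *)
Definition value (xi : label) (f : coord) : K :=
  \sum_(t <- xi) if all (satisfies f) t.1 then ratr t.2 else 0.

Lemma coord_separation (f g : coord) : exists c : seq literal,
  all (satisfies f) c /\ (f <> g -> ~~ all (satisfies g) c).
Proof.
have [->|fg] := pselect (f = g); first by exists [::].
have [i fgi] : exists i, sval f i <> sval g i.
  apply: contrapT => nfg; apply: fg; apply: eq_sig_hprop => /=.
    by move=> ? ? ?; exact: Prop_irrelevance.
  by apply/funext => i; apply: contrapT => fgi; apply: nfg; exists i.
have [l fgl] : exists l, psi (sval f i) l <> psi (sval g i) l.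
  apply: contrapT => nfg; apply: fgi; apply: psi_inj; apply/funext => l.
  by apply: contrapT => fgl; apply: nfg; exists l.
exists [:: (i, l, `[< psi (sval f i) l >])]; split=> /=.
  by rewrite andbT /satisfies.
move=> _; rewrite andbT /satisfies /=; apply/negP => /eqP fgE.
by apply: fgl; apply/propext; split=> /asboolP; [rewrite -fgE|rewrite fgE] => /asboolP.
Qed.

(** Finitely many coordinates are told apart by finitely many literals, so a
    step function can take prescribed rational values at them. *)
Lemma value_dense (s : seq coord) (t : coord -> K) (e : K) : 0 < e ->
  exists xi, forall f, f \in s -> `|value xi f - t f| < e.
Proof.
move=> e0.
have /choice[sep sepP] : forall fg : coord * coord, exists c : seq literal,
    all (satisfies fg.1) c /\ (fg.1 <> fg.2 -> ~~ all (satisfies fg.2) c).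
  by move=> fg; exact: coord_separation.
have /choice[q qP] : forall f : coord, exists q : rat, `|ratr q - t f| < e.
  move=> f; have [|q] := @rat_in_itvoo K (t f - e) (t f + e); first by lra.
  rewrite in_itv /= => /andP[? ?]; exists q; rewrite ltr_norml.
  by apply/andP; split; lra.
(* Among the members of s, only f satisfies its own pattern. *)
pose pattern f := flatten [seq sep (f, g) | g <- s].
have pattern_self f : all (satisfies f) (pattern f).
  by rewrite all_flatten all_map; apply/allP => g _; have [] := sepP (f, g).
have pattern_other f g : g \in s -> f <> g -> ~~ all (satisfies g) (pattern f).
  move=> gs fg; rewrite all_flatten all_map; apply/allPn; exists g => //=.
  by have [_] := sepP (f, g); exact.
exists [seq (pattern f, q f) | f <- undup s] => f fs.
suff -> : value [seq (pattern f, q f) | f <- undup s] f = ratr (q f) by [].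
rewrite /value big_map (bigD1_seq f) ?mem_undup ?undup_uniq//=.
rewrite pattern_self big1 ?addr0// => g /eqP gf.
by rewrite (negbTE (pattern_other _ _ fs gf)).
Qed.

Definition index : Type := I * M * label.

(** The condition on the height makes the coordinates with f i = h i ignore
    all generators of index i. *)
Definition generator (x : index) (f : coord) : K :=
  if `[< strict le x.1.2 (h x.1.1) /\ le (sval f x.1.1) x.1.2 >]
  then value x.2 f else 0.

Definition combination (s : seq (K * index)) (f : coord) : K^o :=
  \sum_(t <- s) t.1 * generator t.2 f.

Definition span_pred : {pred coord -> K^o} :=
  fun v => `[< exists s, v = combination s >].

Lemma span_submod : submod_closed span_pred.
Proof.
split.
  by apply/asboolP; exists [::]; apply/funext => f; rewrite /combination big_nil.
move=> a u v /asboolP[s ->] /asboolP[t ->]; apply/asboolP.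
exists ([seq (a * x.1, x.2) | x <- s] ++ t); apply/funext => f.
rewrite /combination big_cat big_map /=; congr (_ + _).
rewrite /GRing.scale /= /GRing.scale /= mulr_sumr.
by apply: eq_bigr => x _; rewrite mulrA.
Qed.

HB.instance Definition _ := GRing.isSubmodClosed.Build K (coord -> K^o)
  span_pred span_submod.

Definition span_type := {v : coord -> K^o | v \in span_pred}.

HB.instance Definition _ := SubChoice.on span_type.
HB.instance Definition _ := [SubChoice_isSubLmodule of span_type by <:].

Definition evaluation (f : coord) (v : span_type) : K := val v f.

Lemma evaluation_linear f : scalar (evaluation f).
Proof. by move=> a u v. Qed.

HB.instance Definition _ f := GRing.isLinear.Build K span_type K _
  (evaluation f) (evaluation_linear f).

Definition ladder_space : tvsType K :=
  weak_lmod (fun f => evaluation f : {scalar span_type}).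

Lemma ladder_space_hausdorff : hausdorff_space ladder_space.
Proof.
apply: weak_hausdorff => x y xy; apply: val_inj; apply/funext => f; exact: xy.
Qed.

Implicit Types x y v : ladder_space.

Lemma generator_in_span t : generator t \in span_pred.
Proof.
apply/asboolP; exists [:: (1, t)]; apply/funext => f.
by rewrite /combination big_seq1 mul1r.
Qed.

Definition ladder_point t : ladder_space :=
  exist (fun u => u \in span_pred) _ (generator_in_span t) : span_type.

Lemma cofinal2 a b : exists i, strict le a (p i) /\ strict le b (p i).
Proof.
have [[i ai] [j bj]] := (p_cofinal a, p_cofinal b).
have [ij|ji] := wo_total le_wo (p i) (p j).
  by exists j; split=> //; exact: strict_le_trans ij.
by exists i; split=> //; exact: strict_le_trans ji.
Qed.

(** The pinning points have indices (i, g c i, xi), where c bounds the number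
    nu x of the point whose neighborhood is to be met and i is large. *)
Lemma ladder_pinning (nu : ladder_space -> M) (U : ladder_space -> set ladder_space) :
  injective nu -> neighborhood_assignment U ->
  exists g : I -> I -> M, forall x, exists c i xi, U x (ladder_point (i, g c i, xi)).
Proof.
move=> nu_inj Unb.
have /choice[se seP] : forall x, exists se : seq coord * K,
    0 < se.2 /\ weak_ball x se.1 se.2 `<=` U x.
  move=> x; have [Uo Ux] := Unb x.
  by have [s [e se]] := open_nbhs_nbhs (conj Uo Ux); exists (s, e).
(* For i above c, the coordinate values f i < h i relevant to the points
   numbered below p c are at most |M_i| many, hence bounded below h i. *)
have bnd c i : exists b, le (p c) (p i) -> strict le b (h i) /\
    forall x f, strict le (nu x) (p c) -> f \in (se x).1 ->
      strict le (sval f i) (h i) -> le (sval f i) b.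
  have [ci|nci] := pselect (le (p c) (p i)); last by exists (p i).
  pose below := {x | strict le (nu x) (p c)}.
  pose g (xn : below * nat) :=
    oapp (fun f : coord => sval f i) (p i) (onth (se (sval xn.1)).1 xn.2).
  have [|b [bh gb]] := @h_bound i _ g.
    apply: emb_prod (p_inf i) _ (p_inf i).
    apply: emb_trans (emb_set (seg_le le_wo ci)).
    exists (fun x : below => SigSub (mem_set (svalP x : seg le (p c) (nu (sval x))))).
    move=> [x xc] [y yc] /(congr1 val) /= /nu_inj xy.
    by apply: eq_sig_hprop => //= ? ? ?; exact: Prop_irrelevance.
  exists b => _; split=> // x f xc fs fh.
  have /onthP[n fn] := fs; have := gb (exist _ x xc, n).
  rewrite /g /= fn => gfb; exact: strict_le (gfb fh).
have /choice[g gP] : forall ci : I * I, exists b, le (p ci.1) (p ci.2) ->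
    strict le b (h ci.2) /\ forall x f, strict le (nu x) (p ci.1) ->
      f \in (se x).1 ->
      strict le (sval f ci.2) (h ci.2) -> le (sval f ci.2) b.
  by move=> [c i]; exact: bnd.
exists (fun c i => g (c, i)) => x.
have [e0 sU] := seP x; have [c xc] := p_cofinal (nu x).
(* Beyond b, every coordinate relevant to x is below h. *)
have [b bP] := wo_bound_seq le_wo (se x).1 (fun f => sval (cid (svalP f)))
  (inhabits (p c)).
have [i [[bi _] [ci _]]] := cofinal2 b (p c).
have [gh fg] := gP (c, i) ci.
have [xi xiP] := value_dense (se x).1 (fun f => val x f) e0.
exists c, i, xi; apply: sU => f fs.
have fh : strict le (sval f i) (h i).
  by apply: (svalP (cid (svalP f))); exact: wo_trans (bP f fs) bi.
suff E : generator (i, g (c, i), xi) f = value xi f.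
  by have := xiP f fs; rewrite -E.
rewrite /generator; case: asboolP => // nP.
by case: nP; split=> //; exact: fg xc fs fh.
Qed.

(** All vectors of D vanish at a common coordinate f, which is adapted to
    their expansions, whereas the generator (i0, f i0, xi) takes the value 1
    there when xi is the label of the constant function 1. *)
Lemma ladder_not_dense (D : set ladder_space) i0 :
  emb D (seg le (p i0)) -> ~ dense D.
Proof.
move=> Di0.
have /choice[rep repP] : forall v : ladder_space, exists s,
    val v = combination s by move=> v; exact: (asboolP _ (valP v)).
have /choice[b bP] : forall i, exists b, le (p i0) (p i) ->
    strict le b (h i) /\ forall y n t, D y -> onth (rep y) n = Some t ->
      strict le t.2.1.2 (h i) -> strict le t.2.1.2 b.
  move=> i; have [i0i|ni0i] := pselect (le (p i0) (p i)); last by exists (p i).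
  have [|b [bh gb]] := @h_bound i (D * nat)%type
      (fun yn => oapp (fun t : K * index => t.2.1.2) (p i) (onth (rep (val yn.1)) yn.2)).
    apply: emb_prod (p_inf i) _ (p_inf i).
    exact: emb_trans Di0 (emb_set (seg_le le_wo i0i)).
  exists b => _; split=> // y n t Dy yn.
  by have := gb (SigSub (mem_set Dy), n); rewrite /= yn.
(* From i0 on, f i exceeds every height below h i in the expansions of the
   vectors of D; before i0, the value h i exceeds all of them. *)
pose f i := if le (p i0) (p i) then b i else h i.
have fP : exists a, forall i, le a (p i) -> strict le (f i) (h i).
  by exists (p i0) => i i0i; rewrite /f i0i; exact: (bP i i0i).1.
pose fc : coord := exist _ f fP.
have fD y : D y -> evaluation fc y = 0.
  move=> Dy; rewrite /evaluation repP; apply: big_onth0 => n [r [[i a] xi]] yn /=.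
  rewrite /generator /=; case: asboolP => [[ah fa]|_]; last by rewrite mulr0.
  exfalso; move: fa; rewrite /f; case: ifP => [i0i|_]; last first.
    by move=> ha; apply/(strictNge le_wo): ha.
  by have := (bP i i0i).2 _ _ _ Dy yn ah => /(strictNge le_wo).
move=> /(_ [set v | evaluation fc v != 0]) [||v [] /eqP v0 /fD //].
- exists (ladder_point (i0, b i0, [:: ([::], 1)])).
  have i00 := wo_refl le_wo (p i0).
  suff E : generator (i0, b i0, [:: ([::], 1)]) fc = 1.
    by rewrite /= -[evaluation _ _]/(generator _ fc) E oner_neq0.
  rewrite /generator; case: asboolP => [_|nP].
    by rewrite /value big_seq1 /= rmorph1.
  case: nP; split; first exact: (bP i0 i00).1.
  by rewrite /= /f i00; exact: wo_refl.
- apply: (@open_comp _ _ (fun v : ladder_space => evaluation fc v : K) [set r | r != 0]).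
    by move=> v _; exact: (@ev_continuous _ _ _ (fun f => evaluation f : {scalar span_type}) fc v).
  exact: open_neq.
Qed.

Lemma ladder_card : emb nat M -> emb K M -> emb I M -> emb L M ->
  emb ladder_space M.
Proof.
move=> nM KM IM LM.
have /choice[rep repP] : forall v : ladder_space, exists s,
    val v = combination s by move=> v; exact: (asboolP _ (valP v)).
apply: (@emb_trans (seq (K * index))).
  by exists rep => x y xy; apply: val_inj; rewrite !repP xy.
apply: emb_seq => //; apply: emb_prod => //; apply: emb_prod => //.
  by apply: emb_prod => //; exact: emb_refl.
apply: emb_seq => //; apply: emb_prod => //; last first.
  by apply: emb_trans nM; exists pickle; exact: (pcan_inj pickleK).
apply: emb_seq => //; apply: emb_prod => //; first exact: emb_prod.
exact: emb_trans emb_bool nM.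
Qed.

End Construction.

(** * Pinning down below the density *)

Lemma card_lt_nemb T (M : Type) (A : set T) :
  card_lt A [set: M] -> ~ emb M A.
Proof.
move=> [_ MA] H; apply: MA; apply/card_le_emb.
exact: emb_trans (proj2 (emb_setT M)) H.
Qed.

(** By comparability, a small L whose power set is not below |M| has at least
    |M| subsets. *)
Lemma not_strong_limit_power (M : Type) : infinite_set [set: M] ->
  ~ strong_limit_card M ->
  exists L : set M, ~ emb M L /\ emb M (set L).
Proof.
move=> Minf nsl; apply: contrapT => nL; apply: nsl; split=> // L LM.
have {}LM := card_lt_nemb LM.
have {nL} ML : ~ emb M [set A : set M | A `<=` L].
  move=> H; apply: nL; exists L; split=> //; apply: emb_trans H _.
  exists (fun A : [set A : set M | A `<=` L] => [set l : L | val A (val l)]).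
  move=> [A AL] [B BL] /= E; apply: val_inj => /=.
  have {}AL := set_mem AL; have {}BL := set_mem BL.
  have E' l (Ll : L l) : A l = B l.
    by have := congr1 (fun X : set L => X (SigSub (mem_set Ll))) E.
  by apply/seteqP; split=> x Hx; [rewrite -E'//|rewrite E'//]; [exact: AL|exact: BL].
split; last first.
  by move=> /card_le_emb H; apply: ML; exact: emb_trans (proj1 (emb_setT M)) H.
have [//|H] := emb_total M [set A : set M | A `<=` L].
by apply/card_le_emb; exact: emb_trans H (proj1 (emb_setT M)).
Qed.

(** The density and the pinning down number exist because cardinals are
    well-founded.  For the latter to be bounded by |W| inside the space, a copy
    of W is taken in a dense set of least size. *)
Lemma pd_example_of_pinning (X : topologicalType) (W : Type) :
  (forall U : X -> set X, neighborhood_assignment U ->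
    exists P : set X, (forall x, P `&` U x !=set0) /\ emb P W) ->
  (forall D : set X, dense D -> ~ emb D W) -> pd_example X.
Proof.
move=> pin ndense.
have dT : dense [set: X] by move=> O [x Ox] _; exists x.
have [[D0 D0d] D0min] := emb_min (exist (@dense X) _ dT)
  (fun D : {D | dense D} => sval D : Type).
have [w wi] : emb W D0 by have [/(ndense _ D0d)|] := emb_total D0 W.
pose L0 := range (val \o w).
have L0W : emb L0 W.
  have H t : L0 (val (w t)) by exists t.
  apply: (@emb_surj _ _ (fun t => SigSub (mem_set (H t)))) => -[x xL].
  by have [t _ tx] := set_mem xL; exists t; exact: val_inj.
pose F := [set L : set X | exists2 U : X -> set X,
  neighborhood_assignment U & is_pd_family (range U) L].
have FW L : F L -> emb L W.
  move=> [U Unb [_ Lmin]]; have [P [PU PW]] := pin U Unb.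
  apply: emb_trans PW; apply/card_le_emb; apply: Lmin => _ [x _ <-] _.
  exact: PU.
have WL0 : emb W L0.
  have H t : L0 (val (w t)) by exists t.
  exists (fun t => SigSub (mem_set (H t))) => s t /(congr1 val) /= st.
  by apply: wi; exact: val_inj.
have L0ub L : F L -> L #<= L0.
  by move=> /FW LW; apply/card_le_emb; exact: emb_trans WL0.
have [[K Kub] Kmin] := emb_min
  (exist (fun K => forall L, F L -> L #<= K) _ L0ub)
  (fun K : {K : set X | forall L, F L -> L #<= K} => sval K : Type).
have KL0 : emb K L0 by exact: (Kmin (exist _ L0 L0ub)).
exists K, D0; split.
- split=> // L Lub; apply/card_le_emb; exact: (Kmin (exist _ L Lub)).
- split; first by exists D0 => //; exact: card_eqxx.
  by move=> A Ad; apply/card_le_emb; exact: (D0min (exist _ A Ad)).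
- split.
    apply/card_le_emb; apply: emb_trans KL0 (emb_trans L0W _).
    by exists w.
  move=> /card_le_emb DK; apply: (ndense _ D0d).
  exact: emb_trans DK (emb_trans KL0 L0W).
Qed.

Theorem theorem1p4 (R : realType) :
  (exists M : Type, class_S M /\ [set: set nat] #<= [set: M]) ->
  exists V : tvsType R, hausdorff_space V /\ pd_example V.
Proof.
move=> [M [[[Minf [C0 [le [le_wo seg_lt] [[C Ccof CC0] _]] C0M]] nsl] /card_le_emb cM]].
have {}cM : emb (set nat) M.
  exact: emb_trans (proj1 (emb_setT _)) (emb_trans cM (proj2 (emb_setT _))).
have Mn : ~ emb M nat by move=> /(emb_trans cM); exact: nemb_power.
have nM : emb nat M by have [|/Mn] := emb_total nat M.
have RM : emb R M := emb_trans (@emb_real R) cM.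
have seg_small x : ~ emb M (seg le x) := card_lt_nemb (seg_lt x).
have MC : ~ emb M C.
  move=> MC; apply: (card_lt_nemb C0M); apply: emb_trans MC _.
  by apply/card_le_emb; move: CC0; rewrite card_eq_le => /andP[].
have [L [ML [psi psi_inj]]] := not_strong_limit_power Minf nsl.
have p_cof := rung_cofinal le_wo seg_small Mn Ccof MC.
have [h hP] := rung_height le_wo seg_small Mn Ccof MC.
pose I := rung le C.
have MI : ~ emb M I by exact: rung_small.
have p_inf (i : I) : emb nat (seg le (val i)) by exact: rung_inf.
pose p := fun i : I => val i.
have IM : emb I M by exists p; exact: val_inj.
have LM : emb L M by exists val; exact: val_inj.
exists (ladder_space R le p h psi); split; first exact: ladder_space_hausdorff.
apply: (@pd_example_of_pinning _ (I * I * label I L)) => [U Unb|D Dd DW].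
  have [nu nu_inj] := ladder_card le p h psi nM RM IM LM.
  have [g gP] := ladder_pinning le_wo psi_inj p_cof p_inf hP nu_inj Unb.
  pose pt (w : I * I * label I L) : ladder_space R le p h psi :=
    ladder_point R le p h psi (w.1.2, g w.1.1 w.1.2, w.2).
  exists (range pt); split.
    move=> x; have [c [i [xi Ux]]] := gP x; exists (pt (c, i, xi)); split=> //.
  have H t : range pt (pt t) by exists t.
  apply: (@emb_surj _ _ (fun t => SigSub (mem_set (H t)))) => -[x xL].
  by have [t _ tx] := set_mem xL; exists t; exact: val_inj.
have MW : ~ emb M (I * I * label I L).
  have nMb (T : countType) : ~ emb M T.
    by move=> H; apply: Mn; exact: emb_trans H (emb_count _).
  apply: nemb_prod => //; first exact: nemb_prod.
  apply: nemb_seq => //; apply: nemb_prod => //; apply: nemb_seq => //.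
  by apply: nemb_prod => //; exact: nemb_prod.
have MD : ~ emb M D by move=> MD; apply: MW; exact: emb_trans MD DW.
have [i nDi] := rung_exceeds le_wo seg_small Mn Ccof MC MD.
have Di : emb D (seg le (val i)).
  by have [|//] := emb_total D (seg le (val i)).
exact: (ladder_not_dense (p := p) le_wo p_inf hP Di Dd).
Qed.
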